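(* Let $X$ be a Tychonoff space. The following statements are equivalent: \begin{enumerate} \item $C_p(X)$ satisfies $S_{1}(\mathcal{S},\mathcal{A})$; \item $X$ satisfies $S_{1}(\Gamma_F,\mathcal{O})$; \item $C_p(X)$ satisfies $S_{1}(\Gamma_{\mathbf{0}},\mathcal{A}_{\mathbf{0}})$; \item $C_p(X)$ satisfies $S_{1}(\mathcal{S},\mathcal{A}_f)$ for every $f\in C(X)$. \end{enumerate}
   Context: $\mathbb{N}$ is the set of positive integers. $C(X)$ is the set of continuous functions $X\to\mathbb{R}$, $C_p(X)$ is $C(X)$ with the topology of pointwise convergence, and $\mathbf{0}$ is the constant zero function. Covers: a cover $\mathcal{U}$ of $X$ is always nontrivial, i.e. $X=\bigcup\mathcal{U}$ and $X\notin\mathcal{U}$. $\mathcal{O}$ is the family of all open covers of $X$. A cover is a $\gamma$-cover if it is infinite and each $x\in X$ belongs to all but finitely many of its elements. A zero-set of $X$ is a set $g^{-1}(0)$ with $g\in C(X)$; a cozero-set is the complement of a zero-set. A $\gamma$-cover $\mathcal{U}$ of $X$ consisting of cozero-sets is $\gamma_F$-shrinkable if there is a $\gamma$-cover $\{F(U):U\in\mathcal{U}\}$ of $X$ by zero-sets with $F(U)\subset U$ for every $U\in\mathcal{U}$. $\Gamma_F$ is the family of $\gamma_F$-shrinkable $\gamma$-covers of $X$. Families of subsets of $C_p(X)$: - $\mathcal{S}$ is the family of sequentially dense subsets of $C_p(X)$, where $D$ is sequentially dense if every element of $C_p(X)$ is the limit of a sequence of elements of $D$. - $\mathcal{A}$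 is the family of $1$-dense subsets of $C_p(X)$, where $A\subseteq C_p(X)$ is $1$-dense if for each $x\in X$ and each nonempty open $W\subseteq\mathbb{R}$ there is $f\in A$ with $f(x)\in W$. - For $f\in C(X)$, $\mathcal{A}_f$ is the family of sets $B\subseteq C_p(X)$ such that for each $x\in X$ and $\epsilon>0$ there is $h\in B$ with $h(x)\in(f(x)-\epsilon,f(x)+\epsilon)$. - $\Gamma_{\mathbf{0}}$ is the family of infinite sets $A\subseteq C_p(X)$ with $\mathbf{0}\notin A$ such that $A\setminus U$ is finite for every neighborhood $U$ of $\mathbf{0}$ in $C_p(X)$. Selection principle: $S_1(\mathcal{P},\mathcal{Q})$ means: for each sequence $(P_n:n\in\mathbb{N})$ of elements of $\mathcal{P}$ there is a sequence $(b_n)_{n\in\mathbb{N}}$ with $b_n\in P_n$ for each $n$ and $\{b_n:n\in\mathbb{N}\}\in\mathcal{Q}$. *)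

(* Defs.v *)
From HB Require Import structures.
From mathcomp Require Import all_boot all_order all_algebra.
From mathcomp Require Import all_classical all_reals all_analysis.

Set Implicit Arguments.
Unset Strict Implicit.
Unset Printing Implicit Defensive.

Import Order.TTheory GRing.Theory Num.Theory.
Import numFieldNormedType.Exports.

Local Open Scope classical_set_scope.
Local Open Scope ring_scope.

Definition tychonoff_space (X : topologicalType) : Prop :=
  completely_regular_space X /\ hausdorff_space X.

(* The space C_p(X): the subspace topology inherited from {ptws X -> R}. *)
Definition Cp (X : topologicalType) (R : realType) : Type := continuousType X R.

HB.instance Definition _ (X : topologicalType) (R : realType) :=
  Topological.copy (Cp X R)
    (initial_topology (id : continuousType X R -> {ptws X -> R})).

Definition Cp0 (X : topologicalType) (R : realType) : Cp X R :=
  mkcts (@cst_continuous X R 0).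

(* Sequences are indexed from 0. *)
Definition S1 (T : Type) (P Q : set (set T)) : Prop :=
  forall p : nat -> set T, (forall n, P (p n)) ->
  exists b : nat -> T, (forall n, p n (b n)) /\ Q (range b).

Section covers.
Variable X : topologicalType.
Implicit Types U : set (set X).

Definition is_cover U : Prop := \bigcup_(A in U) A = [set: X] /\ ~ U [set: X].

Definition open_covers : set (set (set X)) :=
  [set U | is_cover U /\ forall A, U A -> open A].

Definition gamma_cover U : Prop :=
  [/\ is_cover U, infinite_set U &
      forall x, finite_set [set A | U A /\ ~ A x]].

Variable R : realType.

Definition zero_set (A : set X) : Prop :=
  exists2 g : X -> R, continuous g & A = g @^-1` [set 0].

Definition cozero_set (A : set X) : Prop :=
  exists2 Z : set X, zero_set Z & A = ~` Z.

(* As in the indexed notation {F(U) : U in U}, the shrinking is the set of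
   values of F, so F need not be injective on U. *)
Definition gammaF_shrinkable U : Prop :=
  exists F : set X -> set X,
    [/\ gamma_cover (F @` U),
        forall A, U A -> zero_set (F A) &
        forall A, U A -> F A `<=` A].

Definition Gamma_F : set (set (set X)) :=
  [set U | [/\ gamma_cover U, forall A, U A -> cozero_set A &
               gammaF_shrinkable U]].

End covers.

Section function_families.
Variables (X : topologicalType) (R : realType).

Definition seq_dense_sets : set (set (Cp X R)) :=
  [set D | forall f : Cp X R, exists u : nat -> Cp X R,
    (forall n, D (u n)) /\ u n @[n --> \oo] --> f].

Definition one_dense_sets : set (set (Cp X R)) :=
  [set A | forall (x : X) (W : set R), open W -> W !=set0 ->
    exists2 f : Cp X R, A f & W (f x)].

Definition approx_sets (f : Cp X R) : set (set (Cp X R)) :=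
  [set B | forall (x : X) (e : R), 0 < e ->
    exists2 h : Cp X R, B h & f x - e < h x < f x + e].

Definition Gamma_0 : set (set (Cp X R)) :=
  [set A | [/\ infinite_set A, ~ A (Cp0 X R) &
    forall V : set (Cp X R), nbhs (Cp0 X R) V -> finite_set (A `\` V)]].

End function_families.

(* Main.v *)
(* A gamma_F-shrinkable cover U yields a sequentially dense set, namely the f
   that equal 1 off some V in U: interpolate between the target on F(V) and 1
   off V.  A 1-dense selection takes a value below 1 at every x, so the
   corresponding members V cover X.  Conversely, a set A converging to 0 yields
   the shrinkable cover {|f| < e}, f in A, with shrinking {|f| <= e/2}, unless
   some |f| < e on all of X, in which case that f alone is already an
   e-approximation of 0 at every point.  Countably many selection games (one for
   each e = 1/i, resp. for each rational constant) are played at once by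
   splitting N into countably many infinite sets. *)
Require Import Defs.
From mathcomp Require Import all_boot all_order all_algebra.
From mathcomp Require Import all_classical all_reals all_analysis.
From mathcomp Require Import lra.

Set Implicit Arguments.
Unset Strict Implicit.
Unset Printing Implicit Defensive.

Import Order.TTheory GRing.Theory Num.Theory.
Import numFieldNormedType.Exports.
Local Open Scope classical_set_scope.
Local Open Scope ring_scope.

(** * Pointwise convergence and cofinite sets of indices *)

Lemma Cp_eval_continuous (R : realType) (X : topologicalType) (x : X) :
  continuous (fun f : Cp X R => f x : R).
Proof.
move=> f.
apply: (@continuous_comp (Cp X R) {ptws X -> R} R id (fun g => g x)).
- exact: (@initial_continuous _ {ptws X -> R}).
- exact: (@proj_continuous X (fun=> R) x).
Qed.

(** The topology of [Cp X R] is initial for the inclusion into [{ptws X -> R}], so a neighborhood of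
    [f] contains the trace of an open set [B] of the product. *)
Lemma Cp_cvgP (R : realType) (X : topologicalType) (u : nat -> Cp X R)
    (f : Cp X R) :
  u n @[n --> \oo] --> f <-> forall x, u n x @[n --> \oo] --> f x.
Proof.
split=> [uf x|uf].
  exact: (cvg_comp u _ uf (@Cp_eval_continuous R X x f)).
have uf' : {ptws, (fun n => u n : X -> R) @ \oo --> (f : X -> R)}.
  by apply/(@pointwise_cvgP X R (fmap (fun n => u n : {ptws X -> R}) \oo)) => x;
    exact: uf.
move=> A [_ [[B oB <-] Bf] BA].
have uB : \forall n \near \oo, B (u n : X -> R).
  by apply: (uf' B); exact: open_nbhs_nbhs.
by apply: (filterS _ uB) => n; exact: (BA (u n)).
Qed.

Lemma finite_near_infty (A : set nat) :
  finite_set A -> \forall n \near \oo, ~ A n.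
Proof.
move=> finA.
exists (\max_(i <- finmap.enum_fset (fset_set A)) i).+1 => // n /= + An.
rewrite ltnNge => /negP; apply; apply: leq_bigmax_seq => //.
by rewrite in_fset_set ?inE.
Qed.

Lemma near_infty_finite (P : nat -> Prop) :
  (\forall n \near \oo, P n) -> finite_set [set n | ~ P n].
Proof.
move=> [N _ NP]; apply: (@sub_finite_set _ _ `I_N) => [n /= nP|].
  by rewrite ltnNge; apply/negP => /NP.
exact: finite_II.
Qed.

(** Round [pickle (i, j)] of the given sequence serves as round [j] of the [i]-th game. The combined
    selection then contains a winning set for every [i], along with other picks, hence the inclusion
    [B' <= B] in the second hypothesis. *)
Lemma S1_countable (T : Type) (P Q : set (set T)) (Qi : nat -> set (set T)) :
  (forall i, S1 P (Qi i)) ->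
  (forall B, (forall i, exists2 B', Qi i B' & B' `<=` B) -> Q B) ->
  S1 P Q.
Proof.
move=> PQi QiQ p Pp.
have [d [pd _]] := PQi 0%N p Pp.
have /choice[c cP] i : exists c : nat -> T,
    (forall j, p (pickle (i, j)) (c j)) /\ Qi i (range c).
  by apply: (PQi i (fun j => p (pickle (i, j)))) => j; exact: Pp.
(* An index that codes no pair belongs to no game; [d] merely supplies a legal pick there. *)
exists (fun n => if pickle_inv n is Some ij then c ij.1 ij.2 else d n); split.
  move=> n; have := @pickle_invK (nat * nat)%type n.
  by case: pickle_inv => [[i j]/= <-|//]; exact: (cP i).1.
apply: QiQ => i; exists (range (c i)); first exact: (cP i).2.
by move=> _ [j _ <-]; exists (pickle (i, j)) => //=; rewrite pickleK_inv.
Qed.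

(** * Gamma-covers, zero-sets and interpolation *)

Section gamma_covers.
Variable X : topologicalType.

(** [L] need not be injective: a member [V] of the image misses some [x], so its fibre lies in the
    finite set of indices whose set misses [x]. Finite fibres make the image of an infinite set
    infinite. *)
Lemma gamma_cover_image (T : Type) (A : set T) (L : T -> set X) :
  infinite_set A -> (forall a, A a -> L a <> [set: X]) ->
  (forall x, finite_set [set a | A a /\ ~ L a x]) -> gamma_cover (L @` A).
Proof.
move=> infA LA finA; split.
- split; last by move=> [a /LA].
  apply/seteqP; split=> // x _.
  have [a [Aa /not_andP[//|/contrapT Lax]]] :=
    infinite_setN0 (infinite_setD infA (finA x)).
  by exists (L a) => //; exists a.
- move=> finLA; apply: infA.
  have : finite_set (\bigcup_(V in L @` A) [set a | A a /\ L a = V]).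
    apply: bigcup_finite => // _ [a Aa <-].
    have /existsNP[x Lax] : ~ forall x, L a x.
      by move=> La; apply: (LA a Aa); apply/seteqP; split.
    by apply: sub_finite_set (finA x) => b /= [Ab ->].
  by apply: sub_finite_set => a Aa; exists (L a) => //; exists a.
- move=> x; apply: sub_finite_set (finite_image L (finA x)).
  by move=> _ [[a Aa <-] Lax]; exists a.
Qed.

Lemma gamma_cover_seq (U : set (set X)) : gamma_cover U ->
  exists W : nat -> set X,
    (forall n, U (W n)) /\ forall x, \forall n \near \oo, W n x.
Proof.
(* [W] is an injection of [nat] into [U], so a point missed by finitely many members is missed at
   finitely many indices. *)
move=> [_ /infiniteP/pcard_leP/unsquash W finU].
exists W; split=> [n|x]; first exact: funS.
have finW : finite_set (W @^-1` [set A | U A /\ ~ A x]).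
  by apply: finite_preimage (finU x) => m n _ _; apply: inj; rewrite inE.
apply: filterS (finite_near_infty finW) => n /= Wn.
by apply: contrapT => Wnx; apply: Wn; split=> //; exact: funS.
Qed.

Variable R : realType.

Lemma zero_set_closed (A : set X) : zero_set R A -> closed A.
Proof.
move=> [g gc ->]; apply: preimage_closed => [x _|]; first exact: gc.
exact: closed_eq.
Qed.

Lemma cozero_set_open (A : set X) : cozero_set R A -> open A.
Proof. by move=> [Z /zero_set_closed cZ ->]; rewrite openC. Qed.

Lemma zero_set_le0 (g : X -> R) :
  continuous g -> zero_set R [set x | g x <= 0].
Proof.
move=> gc; exists (g \max cst 0).
  by apply: max_fun_continuous => //; exact: cst_continuous.
apply/seteqP; split=> x /=; first by move=> /max_idPr.
by move=> /max_idPr.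
Qed.

Lemma zero_set_interpolate (F Z : set X) (h : Cp X R) :
  zero_set R F -> zero_set R Z -> F `&` Z `<=` set0 ->
  exists f : Cp X R, (forall x, F x -> f x = h x) /\ (forall x, Z x -> f x = 1).
Proof.
move=> [u uc ->] [v vc ->] disj.
have den x : `|u x| + `|v x| != 0.
  rewrite paddr_eq0 ?normr_ge0// !normr_eq0.
  apply/negP => /andP[/eqP ux /eqP vx].
  exact: (disj x).
(* A weighted mean of [h] and 1: the weight of [h] vanishes on [Z], that of 1 vanishes on [F], and
   disjointness keeps the denominator nonzero. *)
pose f x := (h x * `|v x| + `|u x|) / (`|u x| + `|v x|).
have normc (g : X -> R) : continuous g -> continuous (fun x => `|g x|).
  by move=> gc x; apply: continuous_comp; [exact: gc|exact: norm_continuous].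
have fc : continuous f.
  move=> x; rewrite /f; apply: cvgM.
    apply: cvgD; last exact: normc.
    by apply: cvgM; [exact: cts_fun|exact: normc].
  by apply: cvgV => //; apply: cvgD; exact: normc.
exists (mkcts fc); split=> x /= gx0; rewrite /mkcts /f.
  have := den x; rewrite gx0 normr0 add0r addr0 => v0.
  by rewrite mulfK.
have := den x; rewrite gx0 normr0 mulr0 add0r addr0 => u0.
by rewrite divff.
Qed.

End gamma_covers.

(** * From sequentially dense sets to shrinkable covers *)

Section function_families.
Variables (X : topologicalType) (R : realType).
Implicit Types (f g h : Cp X R) (A D : set (Cp X R)).

Lemma Cp0E x : Cp0 X R x = 0.
Proof. by []. Qed.

Lemma Gamma_F_seq_dense (U : set (set X)) : Gamma_F R U ->
  @seq_dense_sets X R [set f | exists2 V, U V & forall x, ~ V x -> f x = 1].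
Proof.
move=> [_ Ucoz [F [gF F0 FU]]] h.
have [W [UW Wcvg]] := gamma_cover_seq gF.
have /choice[f fP] n : exists f, (exists2 V, U V & forall x, ~ V x -> f x = 1)
    /\ forall x, W n x -> f x = h x.
  have [V UV WV] := UW n.
  have [Z Z0 VZ] := Ucoz _ UV.
  have FZ : F V `&` Z `<=` set0.
    by move=> x [/(FU V UV)]; rewrite [X in X x -> _]VZ.
  have [f [fh f1]] := zero_set_interpolate h (F0 V UV) Z0 FZ.
  exists f; rewrite -WV; split => //; exists V => // x.
  by rewrite VZ => /contrapT; exact: f1.
exists f; split=> [n|]; first exact: (fP n).1.
(* At each [x] the sequence is eventually equal to [h x], since [x] lies in almost all sets [W n] of
   the shrinking. *)
apply/Cp_cvgP => x; apply: cvg_near_cst.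
by apply: filterS (Wcvg x) => n; exact: (fP n).2.
Qed.

Lemma S1_Gamma_F_open_covers :
  S1 (@seq_dense_sets X R) (@one_dense_sets X R) ->
  S1 (@Gamma_F X R) (@open_covers X).
Proof.
move=> S1SA U GU.
have [b [bU b1]] := S1SA _ (fun n => Gamma_F_seq_dense (GU n)).
have /choice[V VP] n : exists V, U n V /\ forall x, ~ V x -> b n x = 1.
  by have [V] := bU n; exists V.
exists V; split=> [n|]; first exact: (VP n).1.
split; last first.
  move=> _ [n _ <-]; have [_ cozU _] := GU n.
  exact/cozero_set_open/cozU/(VP n).1.
split; last first.
  move=> [n _ VT]; have [[[_ UT] _ _] _ _] := GU n.
  by apply: UT; rewrite -VT; exact: (VP n).1.
apply/seteqP; split=> // x _.
have [|_ [n _ <-] /= bx] := b1 x _ (open_lt (y := 1)).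
  by exists 0 => /=.
exists (V n); first by exists n.
by apply: contrapT => /(VP n).2 bx1; move: bx; rewrite bx1 ltxx.
Qed.

(** * From covers to sets converging to 0, one tolerance at a time *)

Definition eps_approx_sets (e : R) : set (set (Cp X R)) :=
  [set B | forall x, exists2 h : Cp X R, B h & `|h x| < e].

Lemma Gamma_0_finite A x (e : R) : Gamma_0 A -> 0 < e ->
  finite_set [set f | A f /\ ~ `|f x| <= e].
Proof.
move=> [_ _ A0] e0.
have : nbhs (Cp0 X R) [set f : Cp X R | `|f x| < e].
  have /cvgrPdist_lt/(_ e e0) := @Cp_eval_continuous R X x (Cp0 X R).
  by apply: filterS => f /=; rewrite sub0r normrN.
move=> /A0; apply: sub_finite_set => f [Af fx].
by split=> //= fxe; apply: fx; exact: ltW.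
Qed.

Lemma Gamma_0_Gamma_F A (e : R) : Gamma_0 A -> 0 < e ->
  (forall f, A f -> exists x, e <= `|f x|) ->
  Gamma_F R [set [set x | `|f x| < e] | f in A].
Proof.
move=> GA e0 Ae; have [infA _ _] := GA.
have e20 : 0 < e / 2 by rewrite divr_gt0.
have e2e : e / 2 < e by rewrite ltr_pdivrMr ?ltr_pMr ?ltr1n.
pose L f := [set x | `|f x| < e].
have LT f : A f -> L f <> setT.
  move=> /Ae[x fx] LfT; have : L f x by [rewrite LfT|].
  by rewrite /L /= ltNge fx.
have gL : gamma_cover (L @` A).
  apply: gamma_cover_image => // x.
  apply: sub_finite_set (Gamma_0_finite x GA e20) => f [Af fx].
  by split=> // fxe; apply: fx; exact: le_lt_trans fxe e2e.
pose r V := xget (Cp0 X R) [set f | A f /\ L f = V].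
have rP V : (L @` A) V -> A (r V) /\ L (r V) = V.
  move=> [f Af LfV]; apply: (@xgetPex _ _ [set f | A f /\ L f = V]).
  by exists f.
have normc f : continuous (fun x => `|f x|).
  by move=> x; apply: cvg_norm; exact: cts_fun.
pose F V := [set x | `|r V x| <= e / 2].
have FL V : (L @` A) V -> F V `<=` V.
  move=> /rP[_ rV] x /= rx; rewrite -rV /L /=.
  exact: le_lt_trans rx e2e.
split => //.
- move=> _ [f Af <-]; exists [set x | e - `|f x| <= 0].
    by apply: zero_set_le0 => x; apply: cvgB; [exact: cvg_cst|exact: normc].
  by apply/seteqP; split=> x /=; rewrite subr_le0 leNgt;
    [move=> ->|move/negP/negPn].
- exists F; split => //.
  + apply: gamma_cover_image => [|V LV FT|x]; first by case: gL.
      have [f Af fV] := LV; apply: (LT f Af); apply/seteqP; split=> // x _.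
      by rewrite [L f]fV; apply: FL => //; rewrite FT.
    (* Since [V = L (r V)], the sets [V] with [x] outside [F V] are images of the finitely many [f]
       with [|f x| > e / 2]. *)
    apply: sub_finite_set (finite_image L (Gamma_0_finite x GA e20)).
    move=> V [LV FVx].
    by have [Ar rV] := rP V LV; exists (r V).
  + move=> V _; rewrite (_ : F V = [set x | `|r V x| - e / 2 <= 0]).
      by apply: zero_set_le0 => x; apply: cvgB; [exact: normc|exact: cvg_cst].
    by apply/seteqP; split=> x /=; rewrite subr_le0.
Qed.

Lemma S1_Gamma_0_eps_approx (e : R) : 0 < e ->
  S1 (@Gamma_F X R) (@open_covers X) ->
  S1 (@Gamma_0 X R) (eps_approx_sets e).
Proof.
move=> e0 S1G A GA.
have [[m [f [Af fe]]]|small] :=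
    pselect (exists m f, A m f /\ forall x, `|f x| < e).
  (* Round [m] alone wins with [f]; all other rounds pick arbitrarily. *)
  have /choice[b bP] n : exists h, A n h /\ (n = m -> h = f).
    have [->|nm] := eqVneq n m; first by exists f.
    have [infA _ _] := GA n; have [h Ah] := infinite_setN0 infA.
    by exists h; split=> // nm'; rewrite nm' eqxx in nm.
  exists b; split=> [n|x]; first exact: (bP n).1.
  by exists (b m) => //; rewrite (bP m).2.
have GF n : Gamma_F R [set [set x | `|f x| < e] | f in A n].
  apply: Gamma_0_Gamma_F => // f Anf; apply: contrapT => fe.
  apply: small; exists n, f; split=> // x; rewrite ltNge; apply/negP => fx.
  by apply: fe; exists x.
have [V [VA [[VT _] _]]] := S1G _ GF.
have /choice[b bP] n : exists f, A n f /\ [set x | `|f x| < e] = V n.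
  by have [f] := VA n; exists f.
exists b; split=> [n|x]; first exact: (bP n).1.
have [_ [n _ <-]] : (\bigcup_(W in range V) W) x by rewrite VT.
by rewrite -(bP n).2 => bx; exists (b n).
Qed.

Lemma S1_Gamma_0_approx0 :
  S1 (@Gamma_F X R) (@open_covers X) ->
  S1 (@Gamma_0 X R) (@approx_sets X R (Cp0 X R)).
Proof.
move=> S1G.
apply: (@S1_countable _ _ _ (fun i => eps_approx_sets i.+1%:R^-1)) =>
    [i|B BP x e e0].
  by apply: S1_Gamma_0_eps_approx => //; rewrite invr_gt0.
have [i _ ie] := near_infty_natSinv_lt (PosNum e0).
have [B' B'x B'B] := BP i; have [h B'h hx] := B'x x.
exists h; first exact: B'B.
have := lt_trans hx (ie i (leqnn _)).
by rewrite Cp0E ltr_norml sub0r add0r.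
Qed.

(** * Translation to an arbitrary target, and 1-density *)

Definition Cp_sub f g : Cp X R :=
  mkcts (fun x => continuousB (@cts_fun _ _ f x) (@cts_fun _ _ g x)).

Lemma Cp_subE f g x : Cp_sub f g x = f x - g x.
Proof. by []. Qed.

Lemma Gamma_0_range (u : nat -> Cp X R) :
  u n @[n --> \oo] --> Cp0 X R -> (forall n, u n <> Cp0 X R) ->
  Gamma_0 (range u).
Proof.
move=> u0 uN0; split.
(* With a finite range, some value [v] would recur infinitely often; it is nonzero at some [x], so
   [u n x] could not tend to 0. *)
- move=> /finite_range_cst_subsequence[v [J infJ uv]].
  have [n0 Jn0] := infinite_setN0 infJ.
  have /existsNP[x vx] : ~ forall x, v x = 0.
    move=> v0; apply: (uN0 n0); apply/continuousEP => x.
    by rewrite (uv n0).1// v0.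
  apply: infJ; have /Cp_cvgP/(_ x)/cvgrPdist_lt/(_ `|v x|) := u0.
  rewrite normr_gt0 => /(_ (introN eqP vx)) /near_infty_finite.
  by apply: sub_finite_set => n /uv /= ->; rewrite sub0r normrN ltxx.
- by move=> [n _ /uN0].
- move=> V /u0 /near_infty_finite /(finite_image u).
  by apply: sub_finite_set => _ [[n _ <-] nV]; exists n.
Qed.

(** Subtracting [f] from a sequence in [D n] converging to [f] gives a member of [Gamma_0], provided
    no difference is zero. If [f] lies in some [D m], picking it there already suffices. *)
Lemma S1_seq_dense_approx f :
  S1 (@Gamma_0 X R) (@approx_sets X R (Cp0 X R)) ->
  S1 (@seq_dense_sets X R) (@approx_sets X R f).
Proof.
move=> S1G D sD.
have [[m Dmf]|fD] := pselect (exists m, D m f).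
  have /choice[b bP] n : exists h, D n h /\ (n = m -> h = f).
    have [->|nm] := eqVneq n m; first by exists f.
    have [u [uD _]] := sD n f.
    by exists (u 0%N); split=> // nm'; rewrite nm' eqxx in nm.
  exists b; split=> [n|x e e0]; first exact: (bP n).1.
  by exists (b m) => //; rewrite (bP m).2// ltrBlDr ltrDl e0.
have /choice[u uP] n : exists u : nat -> Cp X R,
  (forall k, D n (u k)) /\ u k @[k --> \oo] --> f by exact: sD.
have Gu n : Gamma_0 (range (fun k => Cp_sub (u n k) f)).
  apply: Gamma_0_range => [|k /continuousEP uf].
    apply/Cp_cvgP => x; rewrite Cp0E.
    rewrite [X in _ --> X](_ : _ = f x - f x); last by rewrite subrr.
    by apply: cvgB; [exact: (Cp_cvgP _ _).1 (uP n).2 x|exact: cvg_cst].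
  apply: fD; exists n; suff <- : u n k = f by exact: (uP n).1.
  apply/continuousEP => x; apply/eqP; rewrite -subr_eq0; apply/eqP.
  exact: uf.
have [b [bu b0]] := S1G _ Gu.
have /choice[k kP] n : exists k, Cp_sub (u n k) f = b n.
  by have [k _] := bu n; exists k.
exists (fun n => u n (k n)); split=> [n|x e e0]; first exact: (uP n).1.
have [_ [n _ <-]] := b0 x e e0; rewrite -kP => ux.
exists (u n (k n)) => //; move: ux.
by rewrite Cp0E Cp_subE => /andP[? ?]; apply/andP; split; lra.
Qed.

Lemma S1_one_dense :
  (forall f : Cp X R, S1 (@seq_dense_sets X R) (@approx_sets X R f)) ->
  S1 (@seq_dense_sets X R) (@one_dense_sets X R).
Proof.
move=> S1f.
(* The rationals enumerated as reals; a non-code gives 0, which only repeats a rational. Any open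
   [W] contains a ball around some [q i], so approximating every constant [q i] yields 1-density. *)
pose q i : R := if unpickle i is Some q then ratr q else 0.
apply: (@S1_countable _ _ _ (fun i =>
  @approx_sets X R (mkcts (@cst_continuous X R (q i))))) => [i|B BP x W oW W0].
  exact: S1f.
have [z [Wz [r _ rz]]] := dense_rat W0 oW.
have /nbhs_ballP[e e0 eW] : nbhs (z : R) W by exact: open_nbhs_nbhs.
have [B' B'a B'B] := BP (pickle r).
have [h B'h hx] := B'a x e e0.
exists h; first exact: B'B.
apply: eW; rewrite -rz; move: hx.
by rewrite /ball /= /mkcts /= /q pickleK distrC ltr_distl.
Qed.

End function_families.

Theorem theorem4p3 (R : realType) (X : topologicalType)
    (tychX : tychonoff_space X) :
  [<-> S1 (@seq_dense_sets X R) (@one_dense_sets X R);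
       S1 (@Gamma_F X R) (@open_covers X);
       S1 (@Gamma_0 X R) (@approx_sets X R (Cp0 X R));
       forall f : Cp X R, S1 (@seq_dense_sets X R) (@approx_sets X R f)].
Proof.
tfae.
- exact: S1_Gamma_F_open_covers.
- exact: S1_Gamma_0_approx0.
- by move=> S1G f; exact: S1_seq_dense_approx.
- exact: S1_one_dense.
Qed.
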